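(* In the setting of the context, let $A$ denote the multi-stage adaptive algorithm defined there. Then $A\in\mathcal A(\mathcal C_\tau,\mathcal G,S,\Lambda)$ is successful: $\|S(f)-A(f,\varepsilon)\|_{\mathcal G}\le\varepsilon$ for all $f\in\mathcal C_\tau$ and $\varepsilon>0$. Moreover, for all $f\in\mathcal C_\tau$ and $\varepsilon>0$, $$\max\!\left(n_1,h^{-1}\!\left(\frac{\varepsilon}{|f|_{\mathcal F}}\right)\right)\le\max\!\left(n_1,h^{-1}\!\left(\frac{\varepsilon}{\tau|f|_{\widetilde{\mathcal F}}}\right)\right)\le\operatorname{cost}(A,f,\varepsilon),$$ $$\operatorname{cost}(A,f,\varepsilon)\le\max\!\left(n_1,\,r\,h_1^{-1}\!\left(\frac{\varepsilon}{\tau|f|_{\widetilde{\mathcal F}}}\right)\right)\quad\text{and}\quad\operatorname{cost}(A,f,\varepsilon)\le\max\!\left(n_1,\,r\,h_2^{-1}\!\left(\frac{\tau_{\min}\varepsilon}{\tau|f|_{\mathcal F}}\right)\right).$$ Finally, $A$ is computationally stable, both for $\mathcal F$-balls and for $\widetilde{\mathcal F}$-balls: for each of the two semi-norms $|\cdot|_*\in\{|\cdot|_{\mathcal F},|\cdot|_{\widetilde{\mathcal F}}\}$, $$\sup_{\varepsilon,s>0}\ \frac{\sup\{\operatorname{cost}(A,f,\varepsilon):f\in\mathcal C_\tau,\ |f|_*\le s\}}{\max\bigl(1,\ \inf\{\operatorname{cost}(A,f,\varepsilon):f\in\mathcal C_\tau,\ |f|_*\ge s\}\bigr)}<\infty 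.$$
   Context: **Problem.** $\mathcal F$ is a real linear space of functions with semi-norms $|\cdot|_{\mathcal F}$ and $|\cdot|_{\widetilde{\mathcal F}}$; $\tau_{\min}>0$ satisfies $\tau_{\min}|f|_{\widetilde{\mathcal F}}\le|f|_{\mathcal F}$ for all $f\in\mathcal F$. $\mathcal G$ is a real normed space with norm $\|\cdot\|_{\mathcal G}$, and the solution operator $S:\mathcal F\to\mathcal G$ satisfies $S(cf)=cS(f)$ for $c\ge 0$. For a fixed $\tau>0$, $\mathcal C_\tau=\{f\in\mathcal F:|f|_{\mathcal F}\le\tau|f|_{\widetilde{\mathcal F}}\}$. **Algorithms and cost.** $\Lambda$ is a set of real-valued functions $L$ on $\mathcal F$ with $L(cf)=cL(f)$ for all $c\in\mathbb R$; each $L\in\Lambda$ has a cost $\$(L)\in\mathbb N$. For $\mathcal N\subseteq\mathcal F$, $\mathcal A(\mathcal N,\mathcal G,S,\Lambda)$ is the set of deterministic algorithms $A:\mathcal N\times(0,\infty)\to\mathcal G$ of the form $A(f,\varepsilon)=\phi(L_1(f),\dots,L_m(f))$ with $L_i\in\Lambda$, where $m$ may depend on $\varepsilon$ and the observed values $L_i(f)$, and each $L_i$ may depend on $L_1(f),\dots,L_{i-1}(f)$; $\operatorname{cost}(A,f,\varepsilon)=\$(L_1)+\dots+\$(L_m)$. A fixed-cost algorithm is defined for all $f\in\mathcal F$, has $m$ and the $L_i$ independent of $f$ and $\varepsilon$, and is positively homogeneous in $f$. **Building blocks.** $\mathcal I=\{N_1<N_2<\cdots\}\subseteq\mathbb N_0$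 with $\sup_{i\ge2}N_{i+1}/N_i<\infty$. $\{A_n\}_{n\in\mathcal I}$ are fixed-cost algorithms $A_n:\mathcal F\to\mathcal G$ (using data from $\Lambda$) with $\operatorname{cost}(A_n)=n$ and $\|S(f)-A_n(f)\|_{\mathcal G}\le h(n)|f|_{\mathcal F}$ for all $f\in\mathcal F$, where $h:\mathcal I\to[0,\infty)$ is non-increasing and $\inf_{n\in\mathcal I} h(n)=0$. Put $h^{-1}(\varepsilon)=\min\{n\in\mathcal I:h(n)\le\varepsilon\}$ for $\varepsilon>0$ and assume $\sup_{\varepsilon>0}h^{-1}(\varepsilon)/\max(1,h^{-1}(2\varepsilon))<\infty$. $\{\widetilde F_n\}_{n\in\mathcal I}$ are fixed-cost algorithms $\widetilde F_n:\mathcal F\to[0,\infty)$ with $$-h_-(n)|f|_{\mathcal F}\le|f|_{\widetilde{\mathcal F}}-\widetilde F_n(f)\le h_+(n)|f|_{\mathcal F}\qquad\forall f\in\mathcal F,$$ where $h_\pm:\mathcal I\to[0,\infty)$ are non-increasing with $\inf_{n\in\mathcal I} h_\pm(n)=0$. **Nestedness.** For every $n\in\mathcal I$, $\widetilde F_n$ uses the same data as $A_n$. There is $r>1$ (the cost multiple) such that for every $n\in\mathcal I$ there is $\tilde n\in\mathcal I$ with $n<\tilde n\le rn$ and $A_n$ embedded in $A_{\tilde n}$, where ''$A_n$ is embedded in $A_{n'}$'' means that the data functionals used by $A_n$ are among those used by $A_{n'}$. **Derived quantities.** For $n\in\mathcal I$ with $h_+(n)<1/\tau$: $\mathfrak C_n=1/(1-\tau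 h_+(n))$, $\tilde{\mathfrak c}_n=1+\tau h_-(n)$, $\mathfrak c_n=1+\tau_{\min}h_-(n)$, $h_1(n)=\mathfrak C_n\tilde{\mathfrak c}_nh(n)$, $h_2(n)=\mathfrak C_n\mathfrak c_nh(n)$; and $h_j^{-1}(\varepsilon)=\min\{n\in\mathcal I:h_+(n)<1/\tau,\ h_j(n)\le\varepsilon\}$ for $j=1,2$. **Multi-stage adaptive algorithm $A$.** Set $i=1$ and $n_1=\min\{n\in\mathcal I:h_+(n)<1/\tau\}$. Given $\varepsilon>0$ and $f$: (Stage 1) compute $\widetilde F_{n_i}(f)$ and $\mathfrak C_{n_i}$. (Stage 2) If $\tau\,\mathfrak C_{n_i}h(n_i)\widetilde F_{n_i}(f)\le\varepsilon$, return $A(f,\varepsilon)=A_{n_i}(f)$ and stop. (Stage 3) Otherwise let $n_{i+1}$ be the smallest element of $\mathcal I$ that exceeds $n_i$, is not less than $h^{-1}\bigl(\varepsilon\,\tilde{\mathfrak c}_{n_i}/[\tau\widetilde F_{n_i}(f)]\bigr)$, and is such that $A_{n_i}$ is embedded in $A_{n_{i+1}}$; increase $i$ by $1$ and return to Stage 1. Since data are reused, $\operatorname{cost}(A,f,\varepsilon)$ is the final value $n_i$. **Conventions.** $\varepsilon/0=+\infty$, $h^{-1}(+\infty)=\min\mathcal I$, $h_j^{-1}(+\infty)=n_1$; the infimum of the empty set is $+\infty$ (and a finite number divided by $+\infty$ is $0$). *)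

(* Defs.v *)
From mathcomp Require Export all_boot all_order all_algebra.
From mathcomp Require Export all_classical all_reals all_analysis.
Export numFieldNormedType.Exports.
Export Order.TTheory GRing.Theory Num.Theory.

Set Implicit Arguments.
Unset Strict Implicit.
Unset Printing Implicit Defensive.

Local Open Scope classical_set_scope.
Local Open Scope ring_scope.

Definition is_minimum (P : set nat) (n : nat) : Prop :=
  P n /\ forall k, P k -> (n <= k)%N.

(* Every use below is at a set that the standing assumptions make nonempty;
   the value at the empty set is the junk value 0. *)
Definition minimum (P : set nat) : nat := xget 0%N (is_minimum P).

Record is_seminorm (R : realType) (F : lmodType R) (p : F -> R) : Prop :=
  IsSeminorm {
    seminorm_triangle : forall f g, p (f + g) <= p f + p g;
    seminorm_homogeneous : forall (c : R) f, p (c *: f) = `|c| * p f }.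

Definition cone (R : realType) (F : lmodType R) (normF normFt : F -> R)
  (tau : R) : set F := [set f | normF f <= tau * normFt f].

Section Algorithms.
Context {R : realType} {F : lmodType R}.

Definition observe (f : F) (Ls : seq (F -> R)) : seq R := [seq L f | L <- Ls].

Section AdaptiveAlgorithms.
Context {G : normedModType R}.
Variables (Lambda : set (F -> R)) (price : (F -> R) -> nat).

(* A querying strategy maps the values observed so far to the next functional
   to be evaluated, or to None when no more data is wanted.  [queries q f Ls]
   says that, on input f, the strategy q evaluates exactly the functionals Ls,
   in this order, and then stops. *)
Definition queries (q : seq R -> option (F -> R)) (f : F) (Ls : seq (F -> R))
    : Prop :=
  forall i, (i <= size Ls)%N -> q (observe f (take i Ls)) = onth Ls i.

(* alg, with cost function cost, is a deterministic algorithm on the input set N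
   based on data from Lambda.  For each tolerance eps the choice of the
   functionals, their number and the final map phi are arbitrary functions of
   the observed values only.  The strategy has to stop on every input from N,
   but need not be bounded uniformly in the input. *)
Definition algorithm_class (N : set F) (alg : F -> R -> G)
    (cost : F -> R -> nat) : Prop :=
  exists (q : R -> seq R -> option (F -> R)) (phi : R -> seq R -> G),
    (forall eps ys L, q eps ys = Some L -> Lambda L) /\
    (forall f, N f -> forall eps : R, 0 < eps ->
       exists Ls, [/\ queries (q eps) f Ls,
         alg f eps = phi eps (observe f Ls)
       & cost f eps = (\sum_(L <- Ls) price L)%N]).

End AdaptiveAlgorithms.

Record fixed_algorithm (V : lmodType R) := FixedAlgorithm {
  fa_data : seq (F -> R);
  fa_map : seq R -> V }.

Definition fa_output (V : lmodType R) (A : fixed_algorithm V) (f : F) : V :=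
  fa_map A (observe f (fa_data A)).

Coercion fa_output : fixed_algorithm >-> Funclass.

Definition fa_cost (price : (F -> R) -> nat) (V : lmodType R)
  (A : fixed_algorithm V) : nat := (\sum_(L <- fa_data A) price L)%N.

Definition is_fixed_cost (Lambda : set (F -> R)) (V : lmodType R)
    (A : fixed_algorithm V) : Prop :=
  (forall L, L \in fa_data A -> Lambda L) /\
  (forall (c : R) f, 0 <= c -> A (c *: f) = c *: A f).

Definition embedded (V : lmodType R) (A A' : fixed_algorithm V) : Prop :=
  {subset fa_data A <= fa_data A'}.

End Algorithms.

Arguments fixed_algorithm {R} F V.

Section Multistage.
Context {R : realType} {F : lmodType R} {G : normedModType R}.
Variables (I : set nat) (tau tau_min : R) (h hplus hminus : nat -> R).
Variables (A : nat -> fixed_algorithm F G) (Ft : nat -> fixed_algorithm F R^o).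

(* The argument is an extended real, so that eps / 0 = +oo is allowed; then
   h_inv +oo is the least element of I and h1_inv +oo = h2_inv +oo = n_one. *)
Definition h_inv (e : \bar R) : nat :=
  minimum [set n | I n /\ ((h n)%:E <= e)%E].

Definition n_one : nat := minimum [set n | I n /\ hplus n < 1 / tau].

Definition C_big (n : nat) : R := 1 / (1 - tau * hplus n).
Definition c_tilde (n : nat) : R := 1 + tau * hminus n.
Definition c_small (n : nat) : R := 1 + tau_min * hminus n.
Definition h1 (n : nat) : R := C_big n * c_tilde n * h n.
Definition h2 (n : nat) : R := C_big n * c_small n * h n.

Definition h1_inv (e : \bar R) : nat :=
  minimum [set n | [/\ I n, hplus n < 1 / tau & ((h1 n)%:E <= e)%E]].
Definition h2_inv (e : \bar R) : nat :=
  minimum [set n | [/\ I n, hplus n < 1 / tau & ((h2 n)%:E <= e)%E]].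

Definition stops (f : F) (eps : R) (n : nat) : Prop :=
  tau * C_big n * h n * Ft n f <= eps.

Definition candidates (f : F) (eps : R) (n : nat) : set nat :=
  [set n' | [/\ I n', (n < n')%N,
     (h_inv ((eps * c_tilde n)%:E / (tau * Ft n f)%:E)%E <= n')%N
   & embedded (A n) (A n')]].

(* [reaches f eps n]: n is one of the values n_1, n_2, ... taken during the
   execution of the multi-stage algorithm on (f, eps). *)
Inductive reaches (f : F) (eps : R) : nat -> Prop :=
| reaches_start : reaches f eps n_one
| reaches_next n n' : reaches f eps n -> ~ stops f eps n ->
    is_minimum (candidates f eps n) n' -> reaches f eps n'.

Definition terminates_at (f : F) (eps : R) (n : nat) : Prop :=
  reaches f eps n /\ stops f eps n.

(* The final value n_i; junk value 0 if the execution does not terminate. *)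
Definition multistage_cost (f : F) (eps : R) : nat :=
  xget 0%N (terminates_at f eps).

Definition multistage (f : F) (eps : R) : G := A (multistage_cost f eps) f.

End Multistage.

(* In \bar R, the infimum of the empty set is +oo and x / +oo = 0.  As
   +oo / +oo = 0 as well, finiteness of the numerators has to be required
   separately: only a finite number divided by +oo is meant to be 0. *)
Section Stability.
Context {R : realType} {F : lmodType R}.
Variables (C : set F) (norm : F -> R) (cost : F -> R -> nat).

Definition max_cost (eps s : R) : \bar R :=
  ereal_sup [set ((cost f eps)%:R)%:E | f in [set f | C f /\ norm f <= s]].
Definition min_cost (eps s : R) : \bar R :=
  ereal_inf [set ((cost f eps)%:R)%:E | f in [set f | C f /\ s <= norm f]].

Definition cost_ratio (p : R * R) : \bar R :=
  (max_cost p.1 p.2 / maxe 1 (min_cost p.1 p.2))%E.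

Definition computationally_stable : Prop :=
  (forall eps s : R, 0 < eps -> 0 < s -> (max_cost eps s < +oo)%E) /\
  (ereal_sup (cost_ratio @` [set p : R * R | 0 < p.1 /\ 0 < p.2]%R) < +oo)%E.

End Stability.

(* Main.v *)
Require Import Defs.
From mathcomp Require Import ring lra.

(** Termination and the error bound follow from
      normFt f <= C_big n * Ft n f   and   Ft n f <= c_tilde n * normFt f,
    valid on the cone as soon as hplus n < 1 / tau: the first one turns the
    stopping test into an error bound, the second one shows that every stage
    n with h1 n <= eps / (tau * normFt f) stops.  If stage n does not stop,
    then n < M := h1_inv (eps / (tau * normFt f)), and climbing from n along
    the nested designs yields an admissible next stage in [M, r * M]; hence
    the final stage is at most r * M.  The second upper bound uses
    Ft n f <= c_small n * normF f / tau_min in the same way.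

    The upper and the lower cost bounds at a given norm differ by a rescaling
    of the argument of h_inv by a constant: from n_one on, h1 and h2
    are at most a constant times h.  The doubling condition on h_inv absorbs
    the rescaling, which gives computational stability.

    The multi-stage algorithm is a querying strategy because two inputs that
    agree on all data seen so far take the same decision at the current
    stage. *)

Set Implicit Arguments.
Unset Strict Implicit.
Unset Printing Implicit Defensive.

Local Open Scope classical_set_scope.
Local Open Scope ring_scope.

(** * Least elements of sets of naturals *)

Lemma minimumP (P : set nat) : (exists n, P n) -> is_minimum P (minimum P).
Proof.
move=> exP; apply: xgetPex.
have exb : exists n, `[< P n >] by case: exP => n Pn; exists n; apply/asboolP.
case: (ex_minnP exb) => n /asboolP Pn nmin.
by exists n; split=> // k Pk; apply/nmin/asboolP.
Qed.

Lemma is_minimum_unique (P : set nat) m n :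
  is_minimum P m -> is_minimum P n -> m = n.
Proof.
move=> [Pm lem] [Pn len]; apply/eqP.
by rewrite eqn_leq lem// len.
Qed.

(** * Executions as querying strategies *)

Section AlgorithmClass.
Context {R : realType} {F : lmodType R} {G : normedModType R}.
Implicit Types (f g : F) (eps : R) (D Ls : seq (F -> R)).

Lemma observe_sub f g D Ls : {subset Ls <= D} ->
  observe f D = observe g D -> observe f Ls = observe g Ls.
Proof.
move=> sub /eq_in_map eqD; apply/eq_in_map => L /sub; exact: eqD.
Qed.

(** A strategy sees values only, so it picks any input compatible with the values observed and
    imitates [reading] there. The consistency hypotheses make the outcome independent of the input
    picked. *)
Lemma algorithm_class_reading (Lambda : set (F -> R)) (price : (F -> R) -> nat)
    (N : set F) (alg : F -> R -> G) (cost : F -> R -> nat)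
    (reading : F -> R -> seq (F -> R)) :
  (forall f eps L, N f -> 0 < eps -> L \in reading f eps -> Lambda L) ->
  (forall f g eps i, N f -> N g -> 0 < eps ->
     (i <= size (reading f eps))%N -> (i <= size (reading g eps))%N ->
     observe f (take i (reading f eps)) = observe g (take i (reading g eps)) ->
     onth (reading f eps) i = onth (reading g eps) i) ->
  (forall f g eps, N f -> N g -> 0 < eps ->
     observe f (reading f eps) = observe g (reading g eps) ->
     alg f eps = alg g eps) ->
  (forall f eps, N f -> 0 < eps ->
     cost f eps = (\sum_(L <- reading f eps) price L)%N) ->
  algorithm_class Lambda price N alg cost.
Proof.
move=> inLambda consistent determined costE.
pose P eps (ys : seq R) := [set f | [/\ N f, 0 < eps,
  (size ys <= size (reading f eps))%N &
  ys = observe f (take (size ys) (reading f eps))]].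
pose Q eps (ys : seq R) := [set f | N f /\ ys = observe f (reading f eps)].
(* If no input in [N] is compatible with [ys], then [xget] returns the default [0]. The test sends
   this case to [None], so that only functionals in [Lambda] are ever proposed. *)
exists (fun eps ys => let f := xget 0 (P eps ys) in
  if `[< P eps ys f >] then onth (reading f eps) (size ys) else None).
exists (fun eps ys => alg (xget 0 (Q eps ys)) eps).
split=> [eps ys L /=|f Nf eps eps0].
  case: asboolP => // -[Nf eps0 _ _] eqL; apply: (inLambda _ eps _ Nf eps0).
  by apply/onthP; exists (size ys).
exists (reading f eps); split; last exact: costE.
  move=> i ile /=.
  have size_i : size (observe f (take i (reading f eps))) = i.
    by rewrite size_map size_takel.
  set ys := observe f _.
  have Pf : P eps ys f by rewrite /P /= size_i.
  have Pg := xgetI 0 Pf.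
  case: asboolP => // _; case: Pg => Ng _; rewrite size_i => gi eqg.
  by apply: consistent => //; rewrite -eqg.
have Qf : Q eps (observe f (reading f eps)) f by [].
by have [Ng eqg] := xgetI 0 Qf; apply: determined.
Qed.

Section MultistageReading.
Variables (I : set nat) (tau : R) (h hplus hminus : nat -> R).
Variables (A : nat -> fixed_algorithm F G) (Ft : nat -> fixed_algorithm F R^o).
Hypothesis Ft_data : forall n, I n -> fa_data (Ft n) =i fa_data (A n).

Local Notation stops := (stops tau h hplus Ft).
Local Notation candidates := (candidates I tau h hminus A Ft).
Local Notation reaches := (reaches I tau h hplus hminus A Ft).

Definition new_data n D := [seq L <- undup (fa_data (A n)) | L \notin D].

(* [fa_data (A n)] may contain repetitions, which count towards its cost; the
   repeated functionals are evaluated only once it is known that [A n] is the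
   final algorithm. *)
Definition repeated_data n :=
  sval (perm_to_subseq (undup_subseq (fa_data (A n)))).

(* [run f eps n D Ls m]: started at stage [n] after evaluating [D], the
   execution stops at stage [m], having evaluated [Ls] (which includes [D]). *)
Inductive run f eps : nat -> seq (F -> R) -> seq (F -> R) -> nat -> Prop :=
| run_stop n D : stops f eps n -> run f eps n D (D ++ repeated_data n) n
| run_next n n' D Ls m : ~ stops f eps n -> is_minimum (candidates f eps n) n' ->
    run f eps n' (D ++ new_data n' D) Ls m -> run f eps n D Ls m.

(** The invariant of the execution on entering stage [n]. Uniqueness makes the final list a
    permutation of the data of the last algorithm, hence the cost exact. *)
Definition known n D := [/\ I n, uniq D & D =i fa_data (A n)].

(** Embeddedness puts everything evaluated so far among the data of [A n'], so adding the missing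
    functionals restores the invariant. *)
Lemma known_new f eps n n' D : known n D -> candidates f eps n n' ->
  known n' (D ++ new_data n' D).
Proof.
move=> [In uD eqD] [In' _ _ emb]; split=> //.
  rewrite cat_uniq uD filter_uniq ?undup_uniq// andbT.
  by apply/hasPn => L; rewrite mem_filter => /andP[].
move=> L; rewrite mem_cat mem_filter mem_undup.
case: (boolP (L \in D)) => //= LD; apply/esym/emb.
by rewrite -eqD.
Qed.

(** The common data of [Ft n] and [A n] enter here. Both [stops] and [candidates] depend on the
    input only through [Ft n f], so every decision at stage [n] is determined by the values on
    [D]. *)
Lemma known_observe_Ft f g n D : known n D ->
  observe f D = observe g D -> Ft n f = Ft n g.
Proof.
move=> [In _ eqD] obs; congr (fa_map (Ft n) _); apply: observe_sub obs => L.
by rewrite Ft_data// -eqD.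
Qed.

Lemma known_observe_A f g n D : known n D ->
  observe f D = observe g D -> A n f = A n g.
Proof.
move=> [In _ eqD] obs; congr (fa_map (A n) _); apply: observe_sub obs => L.
by rewrite -eqD.
Qed.

Lemma known_stops f g eps n D : known n D ->
  observe f D = observe g D -> stops f eps n -> stops g eps n.
Proof. by move=> kn obs; rewrite /Defs.stops (known_observe_Ft kn obs). Qed.

Lemma known_candidates f g eps n D : known n D ->
  observe f D = observe g D -> candidates f eps n = candidates g eps n.
Proof. by move=> kn obs; rewrite /Defs.candidates (known_observe_Ft kn obs). Qed.

Lemma run_inv f eps n D Ls m : run f eps n D Ls m ->
  [/\ stops f eps n, Ls = D ++ repeated_data n & m = n] \/
  exists n', [/\ ~ stops f eps n, is_minimum (candidates f eps n) n' &
                 run f eps n' (D ++ new_data n' D) Ls m].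
Proof. by case=> [n' D' st|n1 n' D' L' m' st mn rn]; [left|right; exists n']. Qed.

Lemma run_prefix f eps n D Ls m : run f eps n D Ls m ->
  exists E, Ls = D ++ E.
Proof.
elim=> [n' D' _|n1 n' D' L' m' _ _ _ [E ->]]; first by eexists.
by rewrite -catA; eexists.
Qed.

Lemma run_observe f g eps n D Lf mf Lg mg i :
  run f eps n D Lf mf -> run g eps n D Lg mg ->
  (size D <= i)%N -> observe f (take i Lf) = observe g (take i Lg) ->
  observe f D = observe g D.
Proof.
move=> /run_prefix[E' ->] /run_prefix[E ->] Di /(congr1 (take (size D))).
by rewrite -!map_take !take_takel// !take_size_cat.
Qed.

Lemma run_observe_all f g eps n D Lf mf Lg mg :
  run f eps n D Lf mf -> run g eps n D Lg mg ->
  observe f Lf = observe g Lg -> observe f D = observe g D.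
Proof.
move=> /run_prefix[E' ->] /run_prefix[E ->] /(congr1 (take (size D))).
by rewrite -!map_take !take_size_cat.
Qed.

(** Positions inside [D] are common to both runs. Beyond [D], the inputs agree on [D], hence both
    stop or both move to the same next stage, where the induction applies. *)
Lemma run_consistent f g eps n D Lf mf Lg mg i : known n D ->
  run f eps n D Lf mf -> run g eps n D Lg mg ->
  (i <= size Lf)%N -> (i <= size Lg)%N ->
  observe f (take i Lf) = observe g (take i Lg) -> onth Lf i = onth Lg i.
Proof.
move=> + rf; elim: rf Lg mg => {n D Lf mf}[n D st|n n' D Lf mf nst mn rf IH]
  Lg mg kn rg ile jle obs.
  case: (ltnP i (size D)) => [iD|Di].
    by have [E ->] := run_prefix rg; rewrite !onth_cat iD.
  have obsD := run_observe (run_stop D st) rg Di obs.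
  have [[_ -> _]//|[n' [ng _ _]]] := run_inv rg.
  by case: ng; apply: known_stops obsD _.
case: (ltnP i (size D)) => [iD|Di].
  have [E ->] := run_prefix rg; have [E' ->] := run_prefix rf.
  by rewrite -catA !onth_cat iD.
have obsD := run_observe (run_next nst mn rf) rg Di obs.
have [[sg _ _]|[n'' [ng mn' rg']]] := run_inv rg.
  by case: nst; apply: known_stops (esym obsD) sg.
move: mn'; rewrite -(known_candidates _ kn obsD) => mn'.
rewrite -(is_minimum_unique mn mn') in rg'.
by apply: (IH _ _ _ rg') => //; apply: known_new kn (proj1 mn).
Qed.

Lemma run_determined f g eps n D Lf mf Lg mg : known n D ->
  run f eps n D Lf mf -> run g eps n D Lg mg ->
  observe f Lf = observe g Lg -> mf = mg /\ A mf f = A mf g.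
Proof.
move=> + rf; elim: rf Lg mg => {n D Lf mf}[n D st|n n' D Lf mf nst mn rf IH]
  Lg mg kn rg obs.
  have obsD := run_observe_all (run_stop D st) rg obs.
  have [[_ _ ->]|[n' [ng _ _]]] := run_inv rg.
    by split=> //; apply: known_observe_A obsD.
  by case: ng; apply: known_stops obsD _.
have obsD := run_observe_all (run_next nst mn rf) rg obs.
have [[sg _ _]|[n'' [ng mn' rg']]] := run_inv rg.
  by case: nst; apply: known_stops (esym obsD) sg.
move: mn'; rewrite -(known_candidates _ kn obsD) => mn'.
rewrite -(is_minimum_unique mn mn') in rg'.
by apply: (IH _ _ _ rg') => //; apply: known_new kn (proj1 mn).
Qed.

(** Counting multiplicities, exactly the data of the last algorithm have been evaluated, so their
    total price is [fa_cost] of that algorithm. *)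
Lemma run_perm f eps n D Ls m : known n D -> run f eps n D Ls m ->
  I m /\ perm_eq Ls (fa_data (A m)).
Proof.
move=> + rf; elim: rf => {n D Ls m}[n D _|n n' D Lf mf nst mn rf IH] kn.
  case: kn => In uD eqD; split=> //.
  rewrite /repeated_data; case: perm_to_subseq => s /= /permPr ->.
  rewrite perm_cat2r; apply: uniq_perm => //; first exact: undup_uniq.
  by move=> L; rewrite mem_undup.
by apply: IH; apply: known_new kn (proj1 mn).
Qed.

Local Notation n1 := (n_one I tau hplus).
Local Notation start := (undup (fa_data (A n1))).

(** [reaches] grows at its last stage, [run] unfolds from its first. Quantifying over all
    continuations from stage [n] reconciles the two directions. *)
Lemma reaches_run f eps n : I n1 -> reaches f eps n ->
  exists2 D, known n D & forall Ls m, run f eps n D Ls m ->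
    run f eps n1 start Ls m.
Proof.
move=> In1; elim=> [|n2 n' _ [D kn runD] nst mn].
  exists start => //; split=> //; first exact: undup_uniq.
  by move=> L; rewrite mem_undup.
exists (D ++ new_data n' D); first exact: known_new kn (proj1 mn).
by move=> Ls m rn; apply: runD; apply: run_next rn.
Qed.

Lemma multistage_algorithm_class (Lambda : set (F -> R))
    (price : (F -> R) -> nat) (N : set F) : I n1 ->
  (forall n, I n -> is_fixed_cost Lambda (A n)) ->
  (forall n, I n -> fa_cost price (A n) = n) ->
  (forall f eps, N f -> 0 < eps -> terminates_at I tau h hplus hminus A Ft f eps
     (multistage_cost I tau h hplus hminus A Ft f eps)) ->
  algorithm_class Lambda price N (multistage I tau h hplus hminus A Ft)
    (multistage_cost I tau h hplus hminus A Ft).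
Proof.
move=> In1 A_fixed A_cost term.
pose cost := multistage_cost I tau h hplus hminus A Ft.
pose reading f eps := xget [::] [set Ls | run f eps n1 start Ls (cost f eps)].
have kn1 : known n1 start.
  by split=> // [|L]; rewrite ?undup_uniq ?mem_undup.
have readP f eps : N f -> 0 < eps ->
    run f eps n1 start (reading f eps) (cost f eps).
  move=> Nf eps0; rewrite /reading.
  apply: (@xgetPex _ [::] [set Ls | run f eps n1 start Ls (cost f eps)]).
  have [rc sc] := term f eps Nf eps0.
  have [D kn runD] := reaches_run In1 rc.
  by eexists; apply: runD; apply: run_stop.
apply: (@algorithm_class_reading _ _ _ _ _ reading).
- move=> f eps L Nf eps0; have [Ic] := run_perm kn1 (readP f eps Nf eps0).
  by move=> /perm_mem ->; apply: (A_fixed _ Ic).1.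
- move=> f g eps i Nf Ng eps0.
  exact: run_consistent kn1 (readP f eps Nf eps0) (readP g eps Ng eps0).
- move=> f g eps Nf Ng eps0 obs.
  have [eqc eqA] := run_determined kn1 (readP f eps Nf eps0)
    (readP g eps Ng eps0) obs.
  by rewrite /multistage eqA -/(cost f eps) eqc.
- move=> f eps Nf eps0; have [Ic pe] := run_perm kn1 (readP f eps Nf eps0).
  by rewrite (perm_big _ pe) -[RHS]/(fa_cost price _) A_cost.
Qed.

End MultistageReading.
End AlgorithmClass.

(** * Semi-norms, quotients with zero denominators, and a criterion for stability *)

Lemma seminorm_ge0 (R : realType) (F : lmodType R) (p : F -> R) f :
  is_seminorm p -> 0 <= p f.
Proof.
move=> [tri hom].
have p0 : p 0 = 0 by rewrite -(scale0r f) hom normr0 mul0r.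
have pN : p (- f) = p f by rewrite -scaleN1r hom normrN normr1 mul1r.
by have := tri f (- f); rewrite subrr p0 pN -mulr2n pmulrn_lge0.
Qed.

Section DivergentQuotient.
Context {R : realType}.
Implicit Types (eps x y : R).

(** For [x = 0] the quotient is [+oo] and the right-hand side reads [0 <= eps], so both sides
    hold. *)
Lemma lee_div eps x y : 0 < eps -> 0 <= x ->
  (y%:E <= eps%:E / x%:E)%E = (y * x <= eps).
Proof.
move=> eps0; rewrite le_eqVlt => /predU1P[<-|x0].
  by rewrite inve0 mulr0 gt0_muley ?lte_fin// leey ltW.
by rewrite inver gt_eqF// -EFinM lee_fin ler_pdivlMr.
Qed.

Lemma div_gt0 eps x : 0 < eps -> 0 <= x -> (0 < eps%:E / x%:E)%E.
Proof.
move=> eps0; rewrite le_eqVlt => /predU1P[<-|x0].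
  by rewrite inve0 gt0_muley ?lte_fin.
by rewrite inver gt_eqF// -EFinM lte_fin divr_gt0.
Qed.

Lemma lee_div2 eps x y : 0 < eps -> 0 <= x -> x <= y ->
  (eps%:E / y%:E <= eps%:E / x%:E)%E.
Proof.
move=> eps0; rewrite le_eqVlt => /predU1P[<-|x0] xy.
  by rewrite inve0 gt0_muley ?lte_fin// leey.
have y0 := lt_le_trans x0 xy.
by rewrite !inver !gt_eqF// -!EFinM lee_fin ler_wpM2l ?lef_pV2// ltW.
Qed.

End DivergentQuotient.

(** A single number [L] for each pair [(eps, s)] links the two sides: it bounds the costs outside
    the ball from below and, up to the uniform factor [K], those inside from above. *)
Lemma computationally_stableW (R : realType) (F : lmodType R) (C : set F)
    (norm : F -> R) (cost : F -> R -> nat) (K : R) : 0 <= K ->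
  (forall eps s, 0 < eps -> 0 < s -> exists L : R, [/\ 1 <= L,
     forall f, C f -> norm f <= s -> (cost f eps)%:R <= K * L &
     forall f, C f -> s <= norm f -> L <= (cost f eps)%:R]) ->
  computationally_stable C norm cost.
Proof.
move=> K0 bound.
have maxP eps s L : (forall f, C f -> norm f <= s -> (cost f eps)%:R <= K * L) ->
    (max_cost C norm cost eps s <= (K * L)%:E)%E.
  move=> up; apply: ge_ereal_sup => _ [f [Cf fs] <-].
  by rewrite lee_fin up.
split=> [eps s eps0 s0|].
  have [L [_ up _]] := bound eps s eps0 s0.
  by apply: le_lt_trans (maxP _ _ _ up) _; rewrite ltry.
apply: (@le_lt_trans _ _ K%:E); last by rewrite ltry.
apply: ge_ereal_sup => _ [[eps s] [/= eps0 s0] <-].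
have [L [L1 up lo]] := bound eps s eps0 s0.
have L0 : 0 < L by apply: lt_le_trans L1.
rewrite /cost_ratio /=.
have : (L%:E <= maxe 1 (min_cost C norm cost eps s))%E.
  rewrite le_max; apply/orP; right.
  by apply: le_ereal_inf_tmp => _ [f [Cf fs] <-]; rewrite lee_fin lo.
case: (maxe _ _) => [m| |//]; rewrite ?lee_fin => Lm.
  have m0 := lt_le_trans L0 Lm.
  rewrite inver gt_eqF//.
  apply: (@le_trans _ _ ((K * L)%:E * m^-1%:E)%E).
    by rewrite lee_wpmul2r ?maxP// lee_fin invr_ge0 ltW.
  by rewrite -EFinM lee_fin ler_pdivrMr// ler_wpM2l.
(* The denominator is [+oo]: no element of [C] has norm at least [s], and the ratio is 0. *)
by rewrite invey mule0 lee_fin.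
Qed.

(** * Analysis of the execution on the cone *)

Section Multistage.
Context {R : realType} {F : lmodType R} {G : normedModType R}.
Implicit Types (f : F) (eps e t : R) (m n : nat).
Variables (normF normFt : F -> R).
Hypothesis normF_seminorm : is_seminorm normF.
Hypothesis normFt_seminorm : is_seminorm normFt.
Variable tau_min : R.
Hypothesis tau_min_gt0 : 0 < tau_min.
Hypothesis tau_minP : forall f, tau_min * normFt f <= normF f.
Variable Sol : F -> G.
Variable tau : R.
Hypothesis tau_gt0 : 0 < tau.
Variable I : set nat.
Hypothesis I_nonempty : I !=set0.
Variable A : nat -> fixed_algorithm F G.
Variable h : nat -> R.
Hypothesis h_ge0 : forall n, I n -> 0 <= h n.
Hypothesis h_nonincreasing :
  forall m n, I m -> I n -> (m <= n)%N -> h n <= h m.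
Hypothesis h_inf : inf (h @` I) = 0.
Hypothesis A_error :
  forall n, I n -> forall f, `|Sol f - A n f| <= h n * normF f.
Hypothesis h_inv_doubling :
    (ereal_sup [set ((h_inv I h e%:E)%:R
                      / Num.max 1 (h_inv I h (2 * e)%R%:E)%:R : R)%R%:E
               | e in [set e : R | 0 < e]%R] < +oo)%E.
Variable Ft : nat -> fixed_algorithm F R^o.
Hypothesis Ft_ge0 : forall n, I n -> forall f, 0 <= Ft n f.
Variables hplus hminus : nat -> R.
Hypothesis hplus_ge0 : forall n, I n -> 0 <= hplus n.
Hypothesis hminus_ge0 : forall n, I n -> 0 <= hminus n.
Hypothesis hplus_nonincreasing :
  forall m n, I m -> I n -> (m <= n)%N -> hplus n <= hplus m.
Hypothesis hminus_nonincreasing :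
  forall m n, I m -> I n -> (m <= n)%N -> hminus n <= hminus m.
Hypothesis hplus_inf : inf (hplus @` I) = 0.
Hypothesis Ft_error : forall n, I n -> forall f,
  - hminus n * normF f <= normFt f - Ft n f
  /\ normFt f - Ft n f <= hplus n * normF f.
Variable r : R.
Hypothesis r_gt1 : 1 < r.
Hypothesis nested : forall n, I n -> exists n',
  [/\ I n', (n < n')%N, n'%:R <= r * n%:R & embedded (A n) (A n')].

Local Notation Ctau := (cone normF normFt tau).
Local Notation n1 := (n_one I tau hplus).
Local Notation hI := (h_inv I h).
Local Notation C_big := (C_big tau hplus).
Local Notation c_tilde := (c_tilde tau hminus).
Local Notation stops := (stops tau h hplus Ft).
Local Notation candidates := (candidates I tau h hminus A Ft).
Local Notation reaches := (reaches I tau h hplus hminus A Ft).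
Local Notation terminates_at := (terminates_at I tau h hplus hminus A Ft).
Local Notation cost := (multistage_cost I tau h hplus hminus A Ft).

Lemma vanishing (k : nat -> R) e : (forall n, I n -> 0 <= k n) ->
  inf (k @` I) = 0 -> 0 < e -> exists2 n, I n & k n < e.
Proof.
move=> k0 infk e0.
have hk : has_inf (k @` I).
  split; first by case: I_nonempty => n In; exists (k n), n.
  by exists 0 => _ [n In <-]; apply: k0.
have [_ [n In <-]] := inf_adherent e0 hk.
by rewrite infk add0r => ?; exists n.
Qed.

(** The parameter [t] lets the same lemmas serve both upper cost bounds. *)
Definition inflation t n := C_big n * (1 + t * hminus n).
(* [h1] is [inflated tau] and [h2] is [inflated tau_min]. *)
Definition inflated t n := inflation t n * h n.
Definition inflated_inv t (e : \bar R) : nat :=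
  minimum [set n | [/\ I n, hplus n < 1 / tau & ((inflated t n)%:E <= e)%E]].

Let tau_ge0 : 0 <= tau. Proof. exact: ltW. Qed.
Let tau_min_ge0 : 0 <= tau_min. Proof. exact: ltW. Qed.
Let normF_ge0 f : 0 <= normF f. Proof. exact: seminorm_ge0. Qed.
Let normFt_ge0 f : 0 <= normFt f. Proof. exact: seminorm_ge0. Qed.

(** * Constants and their monotonicity from [n1] on *)

Lemma n_oneP : is_minimum [set n | I n /\ hplus n < 1 / tau] n1.
Proof.
apply: minimumP; have [] := @vanishing hplus (1 / tau) => //.
  by rewrite divr_gt0.
by move=> n In hn; exists n.
Qed.

Lemma I_n_one : I n1. Proof. by case: n_oneP => -[]. Qed.

Lemma ge_n_one n : I n -> (n1 <= n)%N = (hplus n < 1 / tau).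
Proof.
move=> In; have [[In1 n1lt] n1le] := n_oneP.
apply/idP/idP => [le|lt]; last exact: n1le.
by apply: le_lt_trans n1lt; apply: hplus_nonincreasing.
Qed.

(** A nested successor of 0 would satisfy [0 < n' <= r * 0]. Thus [n1], and with it every cost on
    the cone, is at least 1. *)
Lemma I_gt0 n : I n -> (0 < n)%N.
Proof.
case: n => // /nested[n' [_ n'0]].
by rewrite mulr0 leNgt ltr0n n'0.
Qed.

Lemma C_den_gt0 n : I n -> (n1 <= n)%N -> 0 < 1 - tau * hplus n.
Proof.
move=> In; rewrite ge_n_one// ltr_pdivlMr// => lt.
by rewrite subr_gt0 mulrC.
Qed.

Lemma C_big_ge1 n : I n -> (n1 <= n)%N -> 1 <= C_big n.
Proof.
move=> In le; rewrite /Defs.C_big ler_pdivlMr ?C_den_gt0// mul1r.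
by rewrite gerBl mulr_ge0 ?hplus_ge0// ltW.
Qed.

Lemma stop_factor_ge0 n : I n -> (n1 <= n)%N -> 0 <= tau * C_big n * h n.
Proof.
move=> In n1n; apply: mulr_ge0; last exact: h_ge0.
by apply: mulr_ge0 => //; apply: le_trans (C_big_ge1 In n1n).
Qed.

Lemma C_big_nonincreasing m n : I m -> I n -> (n1 <= m <= n)%N ->
  C_big n <= C_big m.
Proof.
move=> Im In /andP[m1 mn].
rewrite /Defs.C_big !div1r lef_pV2 ?posrE ?C_den_gt0//; last exact: leq_trans mn.
by rewrite lerD2l lerN2 ler_pM2l// hplus_nonincreasing.
Qed.

Lemma c_tilde_ge1 n : I n -> 1 <= c_tilde n.
Proof. by move=> In; rewrite lerDl mulr_ge0 ?hminus_ge0// ltW. Qed.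

Lemma inflation_ge1 t n : 0 <= t -> I n -> (n1 <= n)%N -> 1 <= inflation t n.
Proof.
move=> t0 In n1n; rewrite mulr_ege1 ?C_big_ge1//.
by rewrite lerDl mulr_ge0// hminus_ge0.
Qed.

Lemma inflation_nonincreasing t m n : 0 <= t -> I m -> I n -> (n1 <= m <= n)%N ->
  inflation t n <= inflation t m.
Proof.
move=> t0 Im In /andP[m1 mn]; have n1n := leq_trans m1 mn.
apply: ler_pM; rewrite ?(le_trans ler01 (C_big_ge1 In n1n))//.
- by rewrite addr_ge0// mulr_ge0// hminus_ge0.
- by rewrite C_big_nonincreasing// m1.
- by rewrite lerD2l ler_wpM2l// hminus_nonincreasing.
Qed.

Lemma inflated_ge t n : 0 <= t -> I n -> (n1 <= n)%N -> h n <= inflated t n.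
Proof.
by move=> t0 In n1n; rewrite ler_peMl ?h_ge0// inflation_ge1.
Qed.

Lemma inflated_nonincreasing t m n : 0 <= t -> I m -> I n -> (n1 <= m <= n)%N ->
  inflated t n <= inflated t m.
Proof.
move=> t0 Im In /[dup] mn /andP[m1 le]; have n1n := leq_trans m1 le.
apply: ler_pM; rewrite ?h_ge0 ?h_nonincreasing ?inflation_nonincreasing//.
by rewrite (le_trans ler01)// inflation_ge1.
Qed.

(** * Inverses of [h], rescaling, and climbing along nested designs *)

Lemma h_invP (e : \bar R) : (0 < e)%E ->
  is_minimum [set n | I n /\ ((h n)%:E <= e)%E] (hI e).
Proof.
move=> e0; apply: minimumP; case: e e0 => [e| |//]; last first.
  by case: I_nonempty => n In _; exists n; split=> //; apply: leey.
rewrite lte_fin => e0; have [n In hn] := vanishing h_ge0 h_inf e0.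
by exists n; split=> //; rewrite lee_fin ltW.
Qed.

Lemma h_inv_le (e : \bar R) n : (0 < e)%E -> I n -> ((h n)%:E <= e)%E ->
  (hI e <= n)%N.
Proof. by move=> /h_invP[_ le] In hn; apply: le. Qed.

Lemma h_inv_homo (e e' : \bar R) : (0 < e)%E -> (e <= e')%E ->
  (hI e' <= hI e)%N.
Proof.
move=> e0 ee'; have [[Ie he] _] := h_invP e0.
by apply: h_inv_le => //; [apply: lt_le_trans ee'|apply: le_trans ee'].
Qed.

(** From [n1] on the inflation factor is at most its value at [n1], so [h m <= e / inflation t n1]
    suffices. The maximum with [n1] keeps [m] in that range. *)
Lemma inflated_bound t e : 0 <= t -> 0 < e -> exists m,
  [/\ I m, hplus m < 1 / tau, inflated t m <= e &
      (m <= maxn n1 (hI (e / inflation t n1)%:E))%N].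
Proof.
move=> t0 e0; have In1 := I_n_one.
have B0 : 0 < inflation t n1.
  by rewrite (lt_le_trans ltr01)// inflation_ge1.
have eB0 : (0 < (e / inflation t n1)%:E)%E by rewrite lte_fin divr_gt0.
have [[Im hm] _] := h_invP eB0.
set m := maxn _ _.
have Imm : I m by rewrite /m; case: (leqP n1).
have n1m : (n1 <= m)%N by rewrite leq_maxl.
exists m; rewrite -ge_n_one//; split=> //.
apply: (@le_trans _ _ (inflation t n1 * h m)).
  by rewrite ler_wpM2r ?h_ge0// inflation_nonincreasing ?leqnn.
rewrite mulrC -ler_pdivlMr//.
rewrite lee_fin in hm; apply: le_trans hm.
by rewrite h_nonincreasing// leq_maxr.
Qed.

Lemma inflated_invP t (e : \bar R) : 0 <= t -> (0 < e)%E -> is_minimum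
  [set n | [/\ I n, hplus n < 1 / tau & ((inflated t n)%:E <= e)%E]]
  (inflated_inv t e).
Proof.
move=> t0 e0; apply: minimumP; case: e e0 => [e| |//]; last first.
  by move=> _; have [[? ?] _] := n_oneP; exists n1; split=> //; apply: leey.
by rewrite lte_fin => /(inflated_bound t0)[m [? ? ? _]]; exists m.
Qed.

Lemma inflated_inv_homo t (e e' : \bar R) : 0 <= t -> (0 < e)%E -> (e <= e')%E ->
  (inflated_inv t e' <= inflated_inv t e)%N.
Proof.
move=> t0 e0 ee'; have [[Ie he1 he] _] := inflated_invP t0 e0.
have [_ le] := inflated_invP t0 (lt_le_trans e0 ee').
by apply: le; split=> //; apply: le_trans ee'.
Qed.

Lemma inflated_inv_bound t e : 0 <= t -> 0 < e ->
  (inflated_inv t e%:E <= maxn n1 (hI (e / inflation t n1)%:E))%N.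
Proof.
move=> t0 e0; have [m [Im m1 hm lem]] := inflated_bound t0 e0.
by apply: leq_trans lem; apply: (proj2 (inflated_invP t0 _)).
Qed.

(** The maximum with 1 stands on both sides so that the inequality can be iterated. *)
Lemma h_inv_double : exists2 K : R, 1 <= K & forall e, 0 < e ->
  Num.max 1 (hI e%:E)%:R <= K * Num.max 1 (hI (2 * e)%:E)%:R.
Proof.
have := h_inv_doubling; set S := [set _ | _ in _] => ltS.
have [K ltK] : exists K : R, (ereal_sup S <= K%:E)%E.
  case: (ereal_sup S) ltS => [K| |] // _; first by exists K.
  by exists 0; rewrite leNye.
have K1 : 1 <= Num.max 1 K by rewrite le_max lexx.
exists (Num.max 1 K) => // e e0.
have m1 : 1 <= Num.max 1 (hI (2 * e)%:E)%:R :> R by rewrite le_max lexx.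
have m0 := lt_le_trans ltr01 m1.
rewrite ge_max mulr_ege1//= -ler_pdivrMr// le_max.
apply/orP; right; rewrite -lee_fin.
by apply: le_trans ltK; apply: ereal_sup_ubound; exists e.
Qed.

(** With [B <= 2 ^+ k], the doubling inequality is iterated [k] times and monotonicity of [h_inv]
    passes from [2 ^+ k] to [B]. *)
Lemma h_inv_scale (B : R) : 0 < B -> exists2 K : R, 1 <= K & forall e, 0 < e ->
  (hI (e / B)%:E)%:R <= K * Num.max 1 (hI e%:E)%:R.
Proof.
move=> B0; have [D D1 dbl] := h_inv_double.
have [k ltk] : exists k, B <= 2 ^+ k.
  exists (Num.bound B); apply: le_trans (ltW (archi_boundP (ltW B0))) _.
  by rewrite -natrX ler_nat ltnW// ltn_expl.
exists (D ^+ k) => [|e e0]; first exact: exprn_ege1.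
have iter j : Num.max 1 (hI (e / 2 ^+ j)%:E)%:R
    <= D ^+ j * Num.max 1 (hI e%:E)%:R.
  elim: j => [|j IH]; first by rewrite !expr0 divr1 mul1r.
  have ej0 : 0 < e / 2 ^+ j.+1 by rewrite divr_gt0// exprn_gt0.
  apply: le_trans (dbl _ ej0) _.
  have -> : 2 * (e / 2 ^+ j.+1) = e / 2 ^+ j.
    by rewrite exprS invfM mulrCA mulVKf ?pnatr_eq0.
  by rewrite exprS -mulrA ler_wpM2l// (le_trans ler01 D1).
apply: le_trans (iter k).
rewrite le_max; apply/orP; right; rewrite ler_nat h_inv_homo//.
  by rewrite lte_fin divr_gt0// exprn_gt0.
by rewrite lee_fin ler_wpM2l ?(ltW e0)// lef_pV2 ?posrE ?exprn_gt0.
Qed.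

(** Nested successors are taken until [M] is reached; the last one before it is below [M], so the
    next is at most [r * M]. Embeddings compose along the way. *)
Lemma nested_above n M : I n -> (n < M)%N -> exists k,
  [/\ I k, (n < k)%N, (M <= k)%N, k%:R <= r * M%:R & embedded (A n) (A k)].
Proof.
have [d] := ubnP (M - n); elim: d n => // d IH n leMn In nM.
have [n' [In' nn' n'r emb]] := nested In.
case: (leqP M n') => [Mn'|n'M].
  exists n'; split=> //; apply: le_trans n'r _.
  by rewrite ler_pM2l ?ler_nat 1?ltnW// (lt_trans _ r_gt1).
have [|k [Ik n'k Mk kr emb']] := IH n' _ In' n'M.
  by rewrite ltnS in leMn; apply: leq_trans leMn; rewrite ltn_sub2l.
exists k; split=> //; first exact: ltn_trans n'k.
by move=> L /emb/emb'.
Qed.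

(** * Estimates at a single stage *)

Lemma reaches_I f eps n : reaches f eps n -> I n /\ (n1 <= n)%N.
Proof.
elim=> [|m n' _ [Im m1] _ [[In' mn' _ _] _]]; first by split; [apply: I_n_one|].
by split=> //; apply: leq_trans (ltnW mn').
Qed.

Lemma Ft_le_tilde n f : I n -> Ctau f -> Ft n f <= c_tilde n * normFt f.
Proof.
move=> In Cf; have [lo _] := Ft_error In f.
have : hminus n * normF f <= hminus n * (tau * normFt f).
  by rewrite ler_wpM2l ?hminus_ge0.
move: lo; rewrite /Defs.c_tilde; lra.
Qed.

(** The lower error bound again, now expressed through [normF] alone: [tau_minP] absorbs the term in
    [normFt f]. *)
Lemma Ft_le_small n f : I n -> Ft n f * tau_min <= (1 + tau_min * hminus n) * normF f.
Proof.
move=> In; have [lo _] := Ft_error In f.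
have : tau_min * Ft n f <= tau_min * (normFt f + hminus n * normF f).
  by rewrite ler_pM2l//; move: lo; lra.
have := tau_minP f; lra.
Qed.

(** On the cone, [normFt f <= Ft n f + tau * hplus n * normFt f]; this is solved for [normFt f], the
    coefficient [1 - tau * hplus n] being positive from [n1] on. *)
Lemma normFt_le_Ft n f : I n -> (n1 <= n)%N -> Ctau f ->
  normFt f <= C_big n * Ft n f.
Proof.
move=> In n1n Cf; have [_ up] := Ft_error In f.
have D0 := C_den_gt0 In n1n.
rewrite /Defs.C_big mulrAC ler_pdivlMr// mul1r.
have : hplus n * normF f <= hplus n * (tau * normFt f).
  by rewrite ler_wpM2l ?hplus_ge0.
lra.
Qed.

Let tauFt_ge0 f : 0 <= tau * normFt f. Proof. by rewrite mulr_ge0// ltW. Qed.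
Let tauF_ge0 f : 0 <= tau * normF f. Proof. by rewrite mulr_ge0// ltW. Qed.

(** By [Ft_le_tilde] the tested quantity is at most [inflated tau n * (tau * normFt f)], which does
    not increase with [n]. *)
Lemma stops_h1 f eps n : Ctau f -> 0 < eps -> I n -> (n1 <= n)%N ->
  (inflated_inv tau (eps%:E / (tau * normFt f)%:E)%E <= n)%N -> stops f eps n.
Proof.
move=> Cf eps0 In n1n le.
have [[Im m1 hm] _] := inflated_invP tau_ge0 (div_gt0 eps0 (tauFt_ge0 f)).
move: hm; rewrite lee_div// => hm; move: m1; rewrite -ge_n_one// => m1.
apply: le_trans hm.
apply: (@le_trans _ _ (inflated tau n * (tau * normFt f))); last first.
  by rewrite ler_wpM2r// inflated_nonincreasing// m1.
rewrite /inflated /inflation /Defs.stops.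
rewrite [leRHS](_ : _ = tau * C_big n * h n * (c_tilde n * normFt f)).
  by rewrite ler_wpM2l ?Ft_le_tilde// stop_factor_ge0.
by rewrite /Defs.c_tilde; ring.
Qed.

Lemma stops_h2 f eps n : Ctau f -> 0 < eps -> I n -> (n1 <= n)%N ->
  (inflated_inv tau_min ((tau_min * eps)%:E / (tau * normF f)%:E)%E <= n)%N ->
  stops f eps n.
Proof.
move=> Cf eps0 In n1n le.
have teps0 : 0 < tau_min * eps by rewrite mulr_gt0.
have [[Im m1 hm] _] := inflated_invP tau_min_ge0 (div_gt0 teps0 (tauF_ge0 f)).
move: hm; rewrite lee_div// => hm; move: m1; rewrite -ge_n_one// => m1.
(* The test is multiplied by [tau_min] to bring it into the form of [Ft_le_small]. *)
rewrite /Defs.stops -(ler_pM2l tau_min_gt0); apply: le_trans hm.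
apply: (@le_trans _ _ (inflated tau_min n * (tau * normF f))); last first.
  by rewrite ler_wpM2r// inflated_nonincreasing// m1.
rewrite /inflated /inflation.
rewrite [leRHS](_ : _ =
  tau * C_big n * h n * ((1 + tau_min * hminus n) * normF f)); last by ring.
rewrite [leLHS](_ : _ = tau * C_big n * h n * (Ft n f * tau_min)); last by ring.
by rewrite ler_wpM2l ?Ft_le_small// stop_factor_ge0.
Qed.

Let target_gt0 f eps n : 0 < eps -> I n ->
  (0 < (eps * c_tilde n)%:E / (tau * Ft n f)%:E)%E.
Proof.
move=> eps0 In; apply: div_gt0; last by rewrite mulr_ge0 ?Ft_ge0// ltW.
by rewrite mulr_gt0// (lt_le_trans _ (c_tilde_ge1 In)).
Qed.

(** * Termination and the error bound *)

Lemma candidatesP f eps n : I n -> exists n', is_minimum (candidates f eps n) n'.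
Proof.
move=> In.
pose M := maxn n.+1 (h_inv I h ((eps * c_tilde n)%:E / (tau * Ft n f)%:E)%E).
have [|k [Ik nk Mk _ emb]] := @nested_above n M In; first by rewrite leq_maxl.
exists (minimum (candidates f eps n)); apply: minimumP; exists k; split=> //.
by apply: leq_trans Mk; rewrite leq_maxr.
Qed.

Lemma cost_terminates f eps : Ctau f -> 0 < eps ->
  terminates_at f eps (cost f eps).
Proof.
move=> Cf eps0; apply: xgetPex.
pose m := inflated_inv tau (eps%:E / (tau * normFt f)%:E)%E.
(* Induction on [m - n]: a stage that does not stop lies below [m], and stages increase strictly. *)
suff: forall d n, (m - n < d)%N -> reaches f eps n ->
    exists k, terminates_at f eps k.
  by move=> /(_ (m - n1).+1 n1); apply=> //; apply: reaches_start.
elim=> // d IH n ltd rn; have [In n1n] := reaches_I rn.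
case: (pselect (stops f eps n)) => [sn|nsn]; first by exists n.
have nm : (n < m)%N by rewrite ltnNge; apply/negP => /stops_h1; tauto.
have [n' mn'] := candidatesP f eps In.
apply: (IH n'); last exact: reaches_next mn'.
have [[_ nn' _ _] _] := mn'.
by rewrite ltnS in ltd; apply: leq_trans ltd; rewrite ltn_sub2l.
Qed.

Lemma cost_I f eps : Ctau f -> 0 < eps -> I (cost f eps) /\ (n1 <= cost f eps)%N.
Proof. by move=> Cf /(cost_terminates Cf)[/reaches_I]. Qed.

(** Serves twice: with the cone condition it gives the error bound, and as an upper bound for [h n]
    it gives the lower cost bound. *)
Lemma stops_error f eps n : Ctau f -> I n -> (n1 <= n)%N -> stops f eps n ->
  h n * (tau * normFt f) <= eps.
Proof.
move=> Cf In n1n; apply: le_trans.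
rewrite [leRHS](_ : _ = h n * (tau * (C_big n * Ft n f))); last by ring.
by rewrite ler_wpM2l ?h_ge0// ler_pM2l// normFt_le_Ft.
Qed.

Lemma multistage_error f eps : Ctau f -> 0 < eps ->
  `|Sol f - multistage I tau h hplus hminus A Ft f eps| <= eps.
Proof.
move=> Cf eps0; have [In n1n] := cost_I Cf eps0.
have [_ st] := cost_terminates Cf eps0.
apply: le_trans (A_error In f) _.
apply: le_trans (stops_error Cf In n1n st).
by rewrite ler_wpM2l ?h_ge0.
Qed.

(** * Cost bounds and computational stability *)

Lemma cost_lower f eps : Ctau f -> 0 < eps ->
  (maxn n1 (hI (eps%:E / (tau * normFt f)%:E)%E) <= cost f eps)%N.
Proof.
move=> Cf eps0; have [In n1n] := cost_I Cf eps0.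
have [_ st] := cost_terminates Cf eps0.
rewrite geq_max n1n h_inv_le ?div_gt0//.
by rewrite lee_div// stops_error.
Qed.

Lemma maxn_h_inv_normF_le f eps : Ctau f -> 0 < eps ->
  (maxn n1 (hI (eps%:E / (normF f)%:E)%E)
     <= maxn n1 (hI (eps%:E / (tau * normFt f)%:E)%E))%N.
Proof.
move=> Cf eps0; rewrite geq_max leq_maxl leq_max h_inv_homo ?div_gt0 ?orbT//.
by rewrite lee_div2.
Qed.

(** A final stage other than [n1] is the least candidate after some [n < M] that did not stop. The
    last hypothesis puts the target of Stage 3 at or below [M], so the design found by climbing to
    [[M, r * M]] is a candidate too. *)
Lemma cost_upper f eps M : Ctau f -> 0 < eps -> I M ->
  (forall n, I n -> (n1 <= n)%N -> (M <= n)%N -> stops f eps n) ->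
  (forall n, I n -> h M * (tau * Ft n f) <= eps * c_tilde n) ->
  (cost f eps)%:R <= Num.max n1%:R (r * M%:R).
Proof.
move=> Cf eps0 IM st hM; have [+ _] := cost_terminates Cf eps0.
case=> [|n n' rn nst mn']; first by rewrite le_max lexx.
have [In n1n] := reaches_I rn.
have nM : (n < M)%N by rewrite ltnNge; apply/negP => /st; tauto.
have [k [Ik nk Mk kr emb]] := nested_above In nM.
rewrite le_max; apply/orP; right; apply: le_trans kr.
rewrite ler_nat; apply: (proj2 mn'); split=> //.
apply: leq_trans Mk; apply: h_inv_le => //; first exact: target_gt0.
rewrite lee_div ?hM//; last by rewrite mulr_ge0 ?Ft_ge0// ltW.
by rewrite mulr_gt0// (lt_le_trans _ (c_tilde_ge1 In)).
Qed.

Lemma cost_upper_normFt f eps : Ctau f -> 0 < eps ->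
  (cost f eps)%:R
    <= Num.max n1%:R (r * (inflated_inv tau (eps%:E / (tau * normFt f)%:E)%E)%:R).
Proof.
move=> Cf eps0.
have [[Im m1 hm] _] := inflated_invP tau_ge0 (div_gt0 eps0 (tauFt_ge0 f)).
move: hm; rewrite lee_div// => hm; move: m1; rewrite -ge_n_one// => m1.
apply: cost_upper => // [n In n1n|n In]; first exact: stops_h1.
have c0 := le_trans ler01 (c_tilde_ge1 In).
set m := inflated_inv _ _ in Im m1 hm *.
(* The factor [c_tilde n] of the current stage is matched by the one in the target of Stage 3; what
   remains is [h m <= inflated tau m]. *)
apply: (@le_trans _ _ (h m * (tau * normFt f) * c_tilde n)).
  rewrite -!mulrA ler_wpM2l ?h_ge0// ler_pM2l//.
  by rewrite [leRHS]mulrC Ft_le_tilde.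
rewrite ler_wpM2r//; apply: le_trans hm.
by rewrite ler_wpM2r// inflated_ge.
Qed.

Lemma cost_upper_normF f eps : Ctau f -> 0 < eps ->
  (cost f eps)%:R
    <= Num.max n1%:R
         (r * (inflated_inv tau_min
                 ((tau_min * eps)%:E / (tau * normF f)%:E)%E)%:R).
Proof.
move=> Cf eps0.
have teps0 : 0 < tau_min * eps by rewrite mulr_gt0.
have [[Im m1 hm] _] := inflated_invP tau_min_ge0 (div_gt0 teps0 (tauF_ge0 f)).
move: hm; rewrite lee_div// => hm; move: m1; rewrite -ge_n_one// => m1.
apply: cost_upper => // [n In n1n|n In]; first exact: stops_h2.
have c0 := le_trans ler01 (c_tilde_ge1 In).
set m := inflated_inv tau_min _ in Im m1 hm *.
have hm' : h m * (tau * normF f) <= tau_min * eps.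
  by apply: le_trans hm; rewrite ler_wpM2r// inflated_ge.
rewrite -(ler_pM2l tau_min_gt0).
apply: (@le_trans _ _ (h m * (tau * normF f) * c_tilde n)); last first.
  by rewrite [leRHS]mulrA ler_wpM2r.
rewrite [leLHS](_ : _ = h m * tau * (tau_min * Ft n f)); last by ring.
rewrite [leRHS](_ : _ = h m * tau * (c_tilde n * normF f)); last by ring.
rewrite ler_wpM2l ?mulr_ge0 ?h_ge0//.
(* The target of Stage 3 carries [c_tilde n], so [Ft n f] is first bounded with that factor, and
   [tau_minP] then turns [normFt f] into [normF f]. *)
apply: (@le_trans _ _ (tau_min * (c_tilde n * normFt f))).
  by rewrite ler_pM2l// Ft_le_tilde.
by rewrite mulrCA ler_wpM2l.
Qed.

(** The constants [t], [a], [b], [c] allow one proof for both semi-norms. *)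
Lemma multistage_stable (norm : F -> R) (t a b c : R) : 0 <= t ->
  0 < a -> 0 < b -> 0 < c -> (forall f, 0 <= norm f) ->
  (forall f eps, Ctau f -> 0 < eps -> (cost f eps)%:R
     <= Num.max n1%:R
          (r * (inflated_inv t ((a * eps)%:E / (b * norm f)%:E)%E)%:R)) ->
  (forall f eps, Ctau f -> 0 < eps ->
     (maxn n1 (hI (eps%:E / (c * norm f)%:E)%E) <= cost f eps)%N) ->
  computationally_stable Ctau norm cost.
Proof.
move=> t0 a0 b0 c0 norm0 up lo; have In1 := I_n_one.
have i0 : 0 < inflation t n1 by rewrite (lt_le_trans ltr01)// inflation_ge1.
(* This constant is the ratio between [d = eps / (c * s)], the argument in the lower bound, and
   [a * eps / (b * s * inflation t n1)], the argument that [inflated_inv_bound] produces in the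
   upper one. *)
have [|K K1 scale] := @h_inv_scale (b / (a * c) * inflation t n1).
  by rewrite mulr_gt0// divr_gt0// mulr_gt0.
have K0 := le_trans ler01 K1; have r0 := ltW (lt_trans ltr01 r_gt1).
apply: (@computationally_stableW _ _ _ _ _ (r * K)); first exact: mulr_ge0.
move=> eps s eps0 s0; pose d := eps / (c * s).
have d0 : 0 < d by rewrite divr_gt0// mulr_gt0.
have n1_ge1 : 1 <= n1%:R :> R by rewrite ler1n I_gt0.
pose L : R := Num.max n1%:R (hI d%:E)%:R.
have n1L : n1%:R <= L by rewrite le_max lexx.
have L1 := le_trans n1_ge1 n1L; have L0 := le_trans ler01 L1.
exists L; split=> // f Cf fs; last first.
  have := lo f eps Cf eps0; rewrite geq_max => /andP[n1c hc].
  rewrite ge_max !ler_nat n1c (leq_trans _ hc)//.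
  have cs0 : 0 < c * s by rewrite mulr_gt0.
  have -> : d%:E = (eps%:E / (c * s)%:E)%E.
    by rewrite inver gt_eqF// -EFinM.
  have cf0 : 0 <= c * norm f by rewrite mulr_ge0// ltW.
  by rewrite h_inv_homo ?div_gt0 ?lee_div2 ?ler_pM2l// ltW.
apply: le_trans (up f eps Cf eps0) _.
have rK1 : 1 <= r * K by rewrite mulr_ege1// ltW.
rewrite ge_max; apply/andP; split.
  by apply: le_trans n1L _; rewrite ler_peMl.
rewrite -mulrA ler_wpM2l//.
pose e := a * eps / (b * s).
have bs0 : 0 < b * s by rewrite mulr_gt0.
have e0 : 0 < e by rewrite divr_gt0// mulr_gt0.
apply: (@le_trans _ _ (inflated_inv t e%:E)%:R).
  have -> : e%:E = ((a * eps)%:E / (b * s)%:E)%E.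
    by rewrite inver gt_eqF// -EFinM.
  have bf0 : 0 <= b * norm f by rewrite mulr_ge0// ltW.
  have ae0 := mulr_gt0 a0 eps0; have bs0' := ltW bs0.
  by rewrite ler_nat inflated_inv_homo ?div_gt0 ?lee_div2 ?ler_pM2l.
apply: (@le_trans _ _ (maxn n1 (hI (e / inflation t n1)%:E))%:R).
  by rewrite ler_nat inflated_inv_bound.
have -> : e / inflation t n1 = d / (b / (a * c) * inflation t n1).
  rewrite /e /d; field.
  by rewrite !gt_eqF.
rewrite natr_max ge_max; apply/andP; split.
  by apply: le_trans n1L _; rewrite ler_peMl.
apply: le_trans (scale _ d0) _.
by rewrite ler_wpM2l// ge_max L1 /L le_max lexx orbT.
Qed.

End Multistage.

Theorem theorem3 (R : realType)
  (F : lmodType R) (normF normFt : F -> R)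
  (normF_seminorm : is_seminorm normF) (normFt_seminorm : is_seminorm normFt)
  (tau_min : R) (tau_min_gt0 : 0 < tau_min)
  (tau_minP : forall f, tau_min * normFt f <= normF f)
  (G : normedModType R)
  (Sol : F -> G)
  (Sol_homogeneous : forall (c : R) f, 0 <= c -> Sol (c *: f) = c *: Sol f)
  (tau : R) (tau_gt0 : 0 < tau)
  (Lambda : set (F -> R))
  (Lambda_homogeneous :
    forall L, Lambda L -> forall (c : R) f, L (c *: f) = c * L f)
  (price : (F -> R) -> nat)
  (price_gt0 : forall L, Lambda L -> (0 < price L)%N)
  (N : nat -> nat) (* N i is N_{i+1} *)
  (N_increasing : forall i, (N i < N i.+1)%N)
  (N_ratio : (ereal_sup [set ((N i.+1)%:R / (N i)%:R : R)%R%:E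
                        | i in [set i | (1 <= i)%N]] < +oo)%E)
  (I : set nat) (IE : I = range N)
  (A : nat -> fixed_algorithm F G)
  (A_fixed : forall n, I n -> is_fixed_cost Lambda (A n))
  (A_cost : forall n, I n -> fa_cost price (A n) = n)
  (h : nat -> R)
  (h_ge0 : forall n, I n -> 0 <= h n)
  (h_nonincreasing : forall m n, I m -> I n -> (m <= n)%N -> h n <= h m)
  (h_inf : inf (h @` I) = 0)
  (A_error : forall n, I n -> forall f, `|Sol f - A n f| <= h n * normF f)
  (h_inv_doubling :
    (ereal_sup [set ((h_inv I h e%:E)%:R
                      / Num.max 1 (h_inv I h (2 * e)%R%:E)%:R : R)%R%:E
               | e in [set e : R | 0 < e]%R] < +oo)%E)
  (Ft : nat -> fixed_algorithm F R^o)
  (Ft_fixed : forall n, I n -> is_fixed_cost Lambda (Ft n))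
  (Ft_ge0 : forall n, I n -> forall f, 0 <= Ft n f)
  (hplus hminus : nat -> R)
  (hplus_ge0 : forall n, I n -> 0 <= hplus n)
  (hminus_ge0 : forall n, I n -> 0 <= hminus n)
  (hplus_nonincreasing :
    forall m n, I m -> I n -> (m <= n)%N -> hplus n <= hplus m)
  (hminus_nonincreasing :
    forall m n, I m -> I n -> (m <= n)%N -> hminus n <= hminus m)
  (hplus_inf : inf (hplus @` I) = 0)
  (hminus_inf : inf (hminus @` I) = 0)
  (Ft_error : forall n, I n -> forall f,
    - hminus n * normF f <= normFt f - Ft n f
    /\ normFt f - Ft n f <= hplus n * normF f)
  (Ft_data : forall n, I n -> fa_data (Ft n) =i fa_data (A n))
  (r : R) (r_gt1 : 1 < r)
  (nested : forall n, I n -> exists n',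
    [/\ I n', (n < n')%N, n'%:R <= r * n%:R & embedded (A n) (A n')]) :
  let Ctau := cone normF normFt tau in
  let alg := multistage I tau h hplus hminus A Ft in
  let cost := multistage_cost I tau h hplus hminus A Ft in
  let n1 := n_one I tau hplus in
  let hI := h_inv I h in
  let h1I := h1_inv I tau h hplus hminus in
  let h2I := h2_inv I tau tau_min h hplus hminus in
  (forall f, Ctau f -> forall eps : R, 0 < eps ->
     terminates_at I tau h hplus hminus A Ft f eps (cost f eps)) /\
  algorithm_class Lambda price Ctau alg cost /\
  (forall f, Ctau f -> forall eps : R, 0 < eps -> `|Sol f - alg f eps| <= eps) /\
  (forall f, Ctau f -> forall eps : R, 0 < eps ->
     [/\ (maxn n1 (hI (eps%:E / (normF f)%:E)%E)
            <= maxn n1 (hI (eps%:E / (tau * normFt f)%:E)%E))%N,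
         (maxn n1 (hI (eps%:E / (tau * normFt f)%:E)%E) <= cost f eps)%N,
         (cost f eps)%:R
           <= Num.max n1%:R (r * (h1I (eps%:E / (tau * normFt f)%:E)%E)%:R)
       & (cost f eps)%:R
           <= Num.max n1%:R
                (r * (h2I ((tau_min * eps)%:E / (tau * normF f)%:E)%E)%:R)]) /\
  computationally_stable Ctau normF cost /\
  computationally_stable Ctau normFt cost.

Proof.
move=> Ctau alg cost n1 hI h1I h2I.
have I0 : I !=set0 by rewrite IE; exists (N 0%N), 0%N.
have term f eps : Ctau f -> 0 < eps ->
    terminates_at I tau h hplus hminus A Ft f eps (cost f eps).
  by move=> Cf eps0; eapply cost_terminates; eassumption.
have lower f eps : Ctau f -> 0 < eps ->
    (maxn n1 (hI (eps%:E / (tau * normFt f)%:E)%E) <= cost f eps)%N.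
  by move=> Cf eps0; eapply cost_lower; eassumption.
have lower_le f eps : Ctau f -> 0 < eps ->
    (maxn n1 (hI (eps%:E / (normF f)%:E)%E)
       <= maxn n1 (hI (eps%:E / (tau * normFt f)%:E)%E))%N.
  by move=> Cf eps0; eapply maxn_h_inv_normF_le; eassumption.
(* [h1_inv] is convertible to [inflated_inv tau], and [h2_inv] to [inflated_inv tau_min]. *)
have upper_normFt f eps : Ctau f -> 0 < eps -> (cost f eps)%:R
    <= Num.max n1%:R (r * (h1I (eps%:E / (tau * normFt f)%:E)%E)%:R).
  by move=> Cf eps0; eapply cost_upper_normFt; eassumption.
have upper_normF f eps : Ctau f -> 0 < eps -> (cost f eps)%:R
    <= Num.max n1%:R (r * (h2I ((tau_min * eps)%:E / (tau * normF f)%:E)%E)%:R).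
  by move=> Cf eps0; eapply cost_upper_normF; eassumption.
have stable norm t a b c := @multistage_stable _ _ _ normF normFt tau tau_gt0 I I0
  A h h_ge0 h_nonincreasing h_inf h_inv_doubling Ft hplus hminus hplus_ge0
  hminus_ge0 hplus_nonincreasing hminus_nonincreasing hplus_inf r r_gt1 nested
  norm t a b c.
split; first by move=> f Cf eps; apply: term.
split.
  apply: multistage_algorithm_class => //; first exact: I_n_one.
split.
  by move=> f Cf eps eps0; eapply multistage_error; eassumption.
split; first by move=> f Cf eps eps0; split; auto.
split.
(* For [normF] the bound through [h2_inv] is paired with the weaker lower bound at [eps / normF f],
   whence [c = 1]. *)
- apply: (stable normF tau_min tau_min tau 1) => // [|f|f eps Cf eps0].
  + exact: ltW.
  + exact: seminorm_ge0.
  + by rewrite mul1r (leq_trans (lower_le f eps Cf eps0))// lower.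
(* For [normFt] both bounds have the argument [eps / (tau * normFt f)]. *)
- apply: (stable normFt tau 1 tau tau) => // [|f|f eps Cf eps0].
  + exact: ltW.
  + exact: seminorm_ge0.
  + by rewrite mul1r; apply: upper_normFt.
Qed.
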